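(* The incomplete beta function satisfies the following identities. (i) For every real $x>0$, $$\beta(x+1) = \frac{1}{x} - \beta(x).$$ (ii) For every real $x$ with $0<x<1$, $$\beta(1-x) = \frac{\pi}{\sin \pi x} - \beta(x).$$ (iii) For every real $x$ with $0<x<1$, $$\beta(x+1) = \frac{1}{x} - \frac{\pi}{\sin \pi x} + \beta(1-x).$$
   Context: The incomplete beta function is the one-variable function defined for real $a>0$ by $\beta(a) = \int_{0}^{1} \frac{t^{a-1}}{1+t}\,dt$ (the integral converges for $a>0$). *)

(* Defs.v *)
From Stdlib Require Import Reals Lra ssreflect.
From Coquelicot Require Import Coquelicot.
Open Scope R_scope.

(** Improper Riemann integral: for [0 < a < 1] the integrand is unbounded at
    [0], and [Rpower t _] is [t] to a real power only for [0 < t], whence the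
    one-sided limit at the lower endpoint. *)
Definition incbeta (a : R) : R :=
  RInt_gen (fun t => Rpower t (a - 1) / (1 + t)) (at_right 0) (at_point 1).

Lemma is_RInt_Rpower (a u v : R) : 0 < a -> 0 < u -> u <= v ->
  is_RInt (fun t => Rpower t (a - 1)) u v (Rpower v a / a - Rpower u a / a).
Proof.
intros Ha Hu Huv.
apply: (is_RInt_derive (fun t => Rpower t a / a)).
- intros x; rewrite Rmin_left // Rmax_right // => Hx.
  unfold Rpower; auto_derive; [lra|].
  replace ((a - 1) * ln x) with (a * ln x + - ln x) by ring.
  rewrite exp_plus exp_Ropp exp_ln; [field|]; lra.
- intros x; rewrite Rmin_left // Rmax_right // => Hx.
  apply: ex_derive_continuous; unfold Rpower; auto_derive; lra.
Qed.

Lemma ex_RInt_incbeta (a u v : R) : 0 < u -> 0 < v ->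
  ex_RInt (fun t => Rpower t (a - 1) / (1 + t)) u v.
Proof.
intros Hu Hv; apply: ex_RInt_continuous => x Hx.
assert (0 < x) by (destruct Hx as [Hx _]; revert Hx; apply Rmin_case; lra).
apply: ex_derive_continuous; unfold Rpower; auto_derive; lra.
Qed.

Lemma RInt_incbeta_bound (a u v : R) : 0 < a -> 0 < u -> u <= v ->
  0 <= RInt (fun t => Rpower t (a - 1) / (1 + t)) u v <= Rpower v a / a.
Proof.
intros Ha Hu Huv.
assert (Hp : forall x y, 0 < Rpower x y) by (intros; apply exp_pos).
split.
- apply RInt_ge_0; [lra|apply ex_RInt_incbeta; lra|].
  intros x Hx; left; apply Rdiv_lt_0_compat; [apply Hp|lra].
- apply Rle_trans with (Rpower v a / a - Rpower u a / a).
  + rewrite -(is_RInt_unique _ _ _ _ (is_RInt_Rpower a u v Ha Hu Huv)).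
    apply RInt_le; [lra|apply ex_RInt_incbeta; lra| |].
    * eexists; exact (is_RInt_Rpower a u v Ha Hu Huv).
    * intros x Hx; generalize (Hp x (a - 1)); intros Hq.
      apply (Rmult_le_reg_r (1 + x)); [lra|].
      unfold Rdiv; rewrite Rmult_assoc Rinv_l; nra.
  + assert (0 < Rpower u a / a) by (apply Rdiv_lt_0_compat; auto); lra.
Qed.

(** The integral defining [incbeta a] converges, so its value is not the
    default value of [RInt_gen]. *)
Lemma is_RInt_gen_incbeta (a : R) : 0 < a ->
  is_RInt_gen (fun t => Rpower t (a - 1) / (1 + t)) (at_right 0) (at_point 1)
    (incbeta a).
Proof.
intros Ha; apply (RInt_gen_correct (V := R_CompleteNormedModule)).
set f := fun t => Rpower t (a - 1) / (1 + t).
assert (H : exists l : R, filterlim (fun e => RInt f e 1) (at_right 0) (locally l)).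
{ apply (filterlim_locally_cauchy (U := R_CompleteSpace)).
  intros eps.
  set d := Rpower (a * eps) (/ a).
  assert (Hd : 0 < d) by apply exp_pos.
  assert (Hlt : forall u v, 0 < u -> u <= v -> v < d ->
            Rabs (RInt f u 1 - RInt f v 1) < eps).
  { intros u v Hu Huv Hv.
    assert (Hc : RInt f u 1 - RInt f v 1 = RInt f u v).
    { rewrite -(RInt_Chasles f u v 1) /plus /=; [ring| |];
        apply ex_RInt_incbeta; lra. }
    rewrite Hc.
    destruct (RInt_incbeta_bound a u v Ha Hu Huv) as [H0 H1].
    fold f in H0, H1; rewrite Rabs_pos_eq; [|exact H0].
    apply Rle_lt_trans with (1 := H1).
    assert (Hva : Rpower v a < a * eps).
    { replace (a * eps) with (Rpower d a).
      - apply Rlt_Rpower_l; lra.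
      - unfold d; rewrite Rpower_mult Rinv_l; [|lra].
        apply Rpower_1, Rmult_lt_0_compat; [exact Ha|apply cond_pos]. }
    apply (Rmult_lt_reg_r a); [exact Ha|].
    unfold Rdiv; rewrite Rmult_assoc Rinv_l; lra. }
  exists (fun x => 0 < x < d); split.
  - exists (mkposreal d Hd); intros y Hy Hy0; split; [exact Hy0|].
    change (Rabs (y - 0) < d) in Hy.
    apply Rabs_def2 in Hy; lra.
  - intros u v [Hu Hud] [Hv Hvd]; change (Rabs (RInt f v 1 - RInt f u 1) < eps).
    destruct (Rle_lt_dec u v).
    + rewrite Rabs_minus_sym; apply Hlt; lra.
    + apply Hlt; lra. }
destruct H as [l Hl]; exists l; intros P HP.
apply Filter_prod with (fun e => 0 < e /\ P (RInt f e 1)) (fun y => y = 1).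
- apply filter_and; [|exact (Hl P HP)].
  exists (mkposreal 1 Rlt_0_1); intros y _ Hy; exact Hy.
- reflexivity.
- intros x y [Hx Px] ->; exists (RInt f x 1); split; [|exact Px].
  apply (@RInt_correct R_CompleteNormedModule), ex_RInt_incbeta; simpl; lra.
Qed.

(* Main.v *)
Require Import Defs.
From Stdlib Require Import Reals Lra Lia.
From Coquelicot Require Import Coquelicot.
Open Scope R_scope.

(** The shift identity holds because
    [Rpower t (x - 1) / (1 + t) + Rpower t x / (1 + t) = Rpower t (x - 1)],
    and the integral of the right-hand side over (0, 1] is [1 / x]
    ([incbeta_succ]).

    The reflection formula [incbeta x + incbeta (1 - x) = PI / sin (PI * x)] is
    the partial fraction expansion of the cosecant in disguise.  Iterating the
    shift identity on both terms leaves, without any infinite series,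
      [S_N(x) = sum of (-1)^n / (x + n) over -N <= n <= N]
    plus two values of [incbeta] at points of order [N], which are [O(1/N)] since
    [Rabs (incbeta a) <= 1 / a] ([incbeta_reflection_partial_sum]).  Integrating
    term by term against the Dirichlet kernel [D_N = 1 + 2 sum cos (n t)] gives
      [sin (PI x) * S_N(x) = integral of cos (x t) D_N(t) over [0, PI]],
    whereas [D_N] alone has integral [PI].  The difference of the two is the
    integral of
      [(1 - cos (x t)) D_N(t) = psi(t) sin ((N + 1/2) t)], where
      [psi(t) = 2 sin^2 (x t / 2) / sin (t / 2)].
    For [0 < x < 1] both [psi] and its derivative are bounded on (0, PI], because
    there [0 <= sin (x t / 2) <= sin (t / 2)]; one integration by parts then
    shows that the difference is [O(1/N)] ([cos_dirichlet_defect]).  Letting [N]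
    grow gives the formula, and the third identity combines the other two. *)

(** * The shift identity *)

Lemma is_RInt_gen_Rpower_0_1 (a : R) : 0 < a ->
  is_RInt_gen (fun t => Rpower t (a - 1)) (at_right 0) (at_point 1) (1 / a).
Proof.
intros Ha P [eps HP].
set (d := Rpower (a * eps) (/ a)).
assert (Hd : 0 < d) by apply exp_pos.
apply Filter_prod with (fun u => 0 < u <= 1 /\ u < d) (fun v => v = 1).
- assert (Hm : 0 < Rmin 1 d) by (apply Rmin_case; lra).
  exists (mkposreal _ Hm); intros u Hu Hu0.
  change (Rabs (u - 0) < Rmin 1 d) in Hu.
  apply Rabs_def2 in Hu.
  generalize (Rmin_l 1 d) (Rmin_r 1 d); lra.
- reflexivity.
- intros u v [Hu Hud] ->.
  exists (Rpower 1 a / a - Rpower u a / a); split.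
  + apply is_RInt_Rpower; simpl; lra.
  + apply HP.
    change (Rabs (Rpower 1 a / a - Rpower u a / a - 1 / a) < eps).
    assert (H1 : Rpower 1 a = 1) by (unfold Rpower; rewrite ln_1, Rmult_0_r; apply exp_0).
    assert (Hua : Rpower u a < a * eps).
    { replace (a * eps) with (Rpower d a).
      - apply Rlt_Rpower_l; lra.
      - unfold d; rewrite Rpower_mult, Rinv_l by lra.
        apply Rpower_1, Rmult_lt_0_compat; [exact Ha | apply cond_pos]. }
    rewrite H1.
    replace (1 / a - Rpower u a / a - 1 / a) with (- (Rpower u a / a)) by ring.
    rewrite Rabs_Ropp, Rabs_pos_eq.
    * apply (Rmult_lt_reg_r a); [exact Ha |].
      unfold Rdiv; rewrite Rmult_assoc, Rinv_l; lra.
    * left; apply Rdiv_lt_0_compat; [apply exp_pos | exact Ha].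
Qed.

(** The integrals over [u, 1] with [0 < u <= 1] are the ones that matter for the
    improper integral at [0]; on such ranges [Rpower] is a genuine power and the
    denominator [1 + t] is positive. *)
Lemma positive_range_at_right_0 :
  filter_prod (at_right 0) (at_point 1)
    (fun ab : R * R => 0 < fst ab <= snd ab).
Proof.
apply Filter_prod with (fun u => 0 < u <= 1) (fun v => v = 1).
- exists (mkposreal 1 Rlt_0_1); intros u Hu Hu0.
  change (Rabs (u - 0) < 1) in Hu.
  apply Rabs_def2 in Hu; lra.
- reflexivity.
- intros u v Hu ->; exact Hu.
Qed.

Lemma incbeta_succ (x : R) : 0 < x -> incbeta (x + 1) = 1 / x - incbeta x.
Proof.
intros Hx.
assert (Hsum : is_RInt_gen (fun t => Rpower t (x - 1)) (at_right 0) (at_point 1)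
                 (incbeta x + incbeta (x + 1))).
{ assert (Hx1 : 0 < x + 1) by lra.
  generalize (is_RInt_gen_plus _ _ _ _
                (is_RInt_gen_incbeta x Hx) (is_RInt_gen_incbeta (x + 1) Hx1)).
  apply is_RInt_gen_ext.
  eapply filter_imp; [| exact positive_range_at_right_0].
  intros [u v] Huv t Ht; simpl in *.
  rewrite Rmin_left in Ht by lra.
  assert (Hp : Rpower t (x + 1 - 1) = Rpower t (x - 1) * t).
  { replace (x + 1 - 1) with (x - 1 + 1) by ring.
    rewrite Rpower_plus, (Rpower_1 t); [reflexivity | lra]. }
  rewrite Hp; unfold plus; simpl; field; lra. }
apply (is_RInt_gen_unique (V := R_CompleteNormedModule)) in Hsum.
assert (Hpow := is_RInt_gen_unique (V := R_CompleteNormedModule) _ _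
                  (is_RInt_gen_Rpower_0_1 x Hx)).
rewrite Hpow in Hsum; lra.
Qed.

(** Comparison of the integrand with [Rpower t (a - 1)], whose integral is
    [1 / a]; this makes the remainders of the iterated shift identity vanish. *)
Lemma Rabs_incbeta_le (a : R) : 0 < a -> Rabs (incbeta a) <= 1 / a.
Proof.
intros Ha.
refine (RInt_gen_norm _ _ _ _ _ _
          (is_RInt_gen_incbeta a Ha) (is_RInt_gen_Rpower_0_1 a Ha)).
- eapply filter_imp; [| exact positive_range_at_right_0].
  intros [u v] H; exact (proj2 H).
- eapply filter_imp; [| exact positive_range_at_right_0].
  intros [u v] Huv t Ht; simpl in *.
  assert (Hp : 0 < Rpower t (a - 1)) by apply exp_pos.
  unfold norm; simpl; unfold abs; simpl.
  rewrite Rabs_pos_eq by (left; apply Rdiv_lt_0_compat; lra).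
  apply (Rmult_le_reg_r (1 + t)); [lra |].
  unfold Rdiv; rewrite Rmult_assoc, Rinv_l; nra.
Qed.

(** * Partial fractions of the cosecant *)

(** The terms of index [n] and [-n] are grouped: this symmetric truncation is the
    one that the Dirichlet kernel produces. *)
Fixpoint csc_partial_sum (x : R) (N : nat) : R :=
  match N with
  | O => 1 / x
  | S n => csc_partial_sum x n
           + (-1) ^ S n * (1 / (x + INR (S n)) + 1 / (x - INR (S n)))
  end.

(** The shift identity peels [1 / (x + n)] off [incbeta (x + n)], and
    [1 / (1 - x + n) = - 1 / (x - (n + 1))] off [incbeta (1 - x + n)].  The
    central term [1 / x] belongs to no pair, so the first argument is always
    shifted once more than the second. *)
Lemma incbeta_reflection_partial_sum (x : R) (N : nat) : 0 < x < 1 ->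
  incbeta x + incbeta (1 - x) =
  csc_partial_sum x N
  + (-1) ^ S N * (incbeta (x + INR (S N)) - incbeta (1 - x + INR N)).
Proof.
intros Hx; induction N as [| N IH].
- simpl; rewrite incbeta_succ, Rplus_0_r by lra; ring.
- rewrite IH.
  assert (HN : 0 <= INR N) by apply pos_INR.
  assert (H1 : incbeta (x + INR (S (S N)))
               = 1 / (x + INR (S N)) - incbeta (x + INR (S N))).
  { rewrite <- incbeta_succ by (rewrite S_INR; lra).
    f_equal; rewrite (S_INR (S N)); ring. }
  assert (H2 : incbeta (1 - x + INR (S N))
               = - (1 / (x - INR (S N))) - incbeta (1 - x + INR N)).
  { replace (- (1 / (x - INR (S N)))) with (1 / (1 - x + INR N))
      by (rewrite S_INR; field; lra).
    rewrite <- incbeta_succ by lra.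
    f_equal; rewrite S_INR; ring. }
  rewrite H1, H2; cbn [csc_partial_sum].
  replace ((-1) ^ S (S N)) with (- (-1) ^ S N) by (simpl; ring).
  ring.
Qed.

(** * The Dirichlet kernel *)

Fixpoint dirichlet_kernel (N : nat) (t : R) : R :=
  match N with
  | O => 1
  | S n => dirichlet_kernel n t + 2 * cos (INR (S n) * t)
  end.

Lemma continuous_dirichlet_kernel (N : nat) (t : R) :
  continuous (dirichlet_kernel N) t.
Proof.
apply (ex_derive_continuous (dirichlet_kernel N)).
induction N as [| N IH]; cbn [dirichlet_kernel].
- apply ex_derive_const.
- apply (ex_derive_plus (dirichlet_kernel N)); [exact IH |].
  auto_derive; trivial.
Qed.

Lemma sin_half_dirichlet_kernel (N : nat) (t : R) :
  sin (t / 2) * dirichlet_kernel N t = sin ((INR N + 1 / 2) * t).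
Proof.
induction N as [| N IH]; cbn [dirichlet_kernel].
- rewrite Rmult_1_r; f_equal; simpl; field.
- rewrite Rmult_plus_distr_l, IH.
  replace ((INR N + 1 / 2) * t) with (INR (S N) * t - t / 2)
    by (rewrite S_INR; field).
  replace ((INR (S N) + 1 / 2) * t) with (INR (S N) * t + t / 2) by field.
  rewrite sin_plus, sin_minus; ring.
Qed.

Lemma sin_add_INR_PI (y : R) (n : nat) :
  sin (y + INR n * PI) = (-1) ^ n * sin y.
Proof.
induction n as [| n IH].
- simpl; rewrite Rmult_0_l, Rplus_0_r; ring.
- replace (y + INR (S n) * PI) with (y + INR n * PI + PI) by (rewrite S_INR; ring).
  rewrite neg_sin, IH; simpl; ring.
Qed.

Lemma sin_sub_INR_PI (y : R) (n : nat) :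
  sin (y - INR n * PI) = (-1) ^ n * sin y.
Proof.
replace (sin y) with (sin (y - INR n * PI + INR n * PI)) by (f_equal; ring).
rewrite sin_add_INR_PI, <- Rmult_assoc, <- pow_add.
replace (n + n)%nat with (2 * n)%nat by lia.
rewrite pow_1_even; ring.
Qed.

(** By the product formula, [2 cos (x t) cos (n t)] has the primitive
    [sin ((x + n) t) / (x + n) + sin ((x - n) t) / (x - n)], and at [PI] both
    sines equal [(-1) ^ n * sin (PI * x)]: these are the two terms that
    [csc_partial_sum] gains. *)
Lemma is_RInt_cos_dirichlet_kernel (x : R) (N : nat) : 0 < x < 1 ->
  is_RInt (fun t => cos (x * t) * dirichlet_kernel N t) 0 PI
    (sin (PI * x) * csc_partial_sum x N).
Proof.
intros Hx; induction N as [| N IH]; cbn [dirichlet_kernel csc_partial_sum].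
- replace (sin (PI * x) * (1 / x)) with (minus (sin (x * PI) / x) (sin (x * 0) / x)).
  + apply (is_RInt_derive (fun t => sin (x * t) / x)).
    * intros t _; auto_derive; [trivial | field; lra].
    * intros t _; apply (ex_derive_continuous (fun t => cos (x * t) * 1)).
      auto_derive; trivial.
  + unfold minus, plus, opp; simpl.
    rewrite Rmult_0_r, sin_0, (Rmult_comm x PI); field; lra.
- set (m := INR (S N)).
  assert (Hm : 1 <= m) by (unfold m; rewrite S_INR; generalize (pos_INR N); lra).
  assert (Hstep : is_RInt (fun t => 2 * cos (x * t) * cos (m * t)) 0 PI
     (sin (PI * x) * ((-1) ^ S N * (1 / (x + m) + 1 / (x - m))))).
  { replace (sin (PI * x) * ((-1) ^ S N * (1 / (x + m) + 1 / (x - m))))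
      with (minus (sin ((x + m) * PI) / (x + m) + sin ((x - m) * PI) / (x - m))
                  (sin ((x + m) * 0) / (x + m) + sin ((x - m) * 0) / (x - m))).
    - apply (is_RInt_derive
               (fun t => sin ((x + m) * t) / (x + m) + sin ((x - m) * t) / (x - m))).
      + intros t _; auto_derive; [trivial |].
        rewrite (Rmult_plus_distr_r x m t), (Rmult_minus_distr_r x m t).
        rewrite cos_plus, cos_minus; field; lra.
      + intros t _.
        apply (ex_derive_continuous (fun t => 2 * cos (x * t) * cos (m * t))).
        auto_derive; trivial.
    - unfold minus, plus, opp; simpl.
      rewrite !Rmult_0_r, sin_0.
      replace ((x + m) * PI) with (PI * x + INR (S N) * PI) by (fold m; ring).
      replace ((x - m) * PI) with (PI * x - INR (S N) * PI) by (fold m; ring).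
      rewrite sin_add_INR_PI, sin_sub_INR_PI; cbn [pow]; field; lra. }
  rewrite Rmult_plus_distr_l.
  apply (is_RInt_ext (fun t => plus (cos (x * t) * dirichlet_kernel N t)
                                    (2 * cos (x * t) * cos (m * t)))).
  + intros t _; unfold plus; simpl; ring.
  + exact (is_RInt_plus _ _ _ _ _ _ IH Hstep).
Qed.

Lemma is_RInt_dirichlet_kernel (N : nat) :
  is_RInt (dirichlet_kernel N) 0 PI PI.
Proof.
induction N as [| N IH]; cbn [dirichlet_kernel].
- replace PI with (scal (PI - 0) 1) at 2
    by (unfold scal; simpl; unfold mult; simpl; ring).
  apply (is_RInt_const 0 PI (1 : R)).
- set (m := INR (S N)).
  assert (Hm : 1 <= m) by (unfold m; rewrite S_INR; generalize (pos_INR N); lra).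
  assert (Hstep : is_RInt (fun t => 2 * cos (m * t)) 0 PI 0).
  { replace 0 with (minus (2 * sin (m * PI) / m) (2 * sin (m * 0) / m)) at 2.
    - apply (is_RInt_derive (fun t => 2 * sin (m * t) / m)).
      + intros t _; auto_derive; [trivial | field; lra].
      + intros t _; apply (ex_derive_continuous (fun t => 2 * cos (m * t))).
        auto_derive; trivial.
    - unfold minus, plus, opp; simpl.
      replace (m * PI) with (0 + INR (S N) * PI) by (fold m; ring).
      rewrite sin_add_INR_PI, Rmult_0_r, sin_0; field; lra. }
  rewrite <- (Rplus_0_r PI) at 2.
  exact (is_RInt_plus _ _ _ _ _ _ IH Hstep).
Qed.

(** * Decay of the oscillating remainder *)

(** A quantitative Riemann-Lebesgue lemma: integrating [sin (l * t)] by parts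
    gains the factor [1 / l], at the price of a boundary term of size [2 * M]
    and of the integral of the derivative of [psi]. *)
Lemma oscillatory_integral_bound (psi dpsi : R -> R) (a b l M M' : R) :
  a <= b -> 0 < l ->
  (forall t, a <= t <= b -> is_derive psi t (dpsi t)) ->
  (forall t, a <= t <= b -> continuous dpsi t) ->
  (forall t, a <= t <= b -> Rabs (psi t) <= M) ->
  (forall t, a <= t <= b -> Rabs (dpsi t) <= M') ->
  Rabs (RInt (fun t => psi t * sin (l * t)) a b) <= (2 * M + (b - a) * M') / l.
Proof.
intros Hab Hl Hd Hc HM HM'.
assert (Hcos : forall t, continuous (fun t => cos (l * t)) t).
{ intros t; apply (ex_derive_continuous (fun t => cos (l * t))); auto_derive; trivial. }
assert (Hsin : forall t, continuous (fun t => sin (l * t)) t).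
{ intros t; apply (ex_derive_continuous (fun t => sin (l * t))); auto_derive; trivial. }
assert (Hc1 : forall t, a <= t <= b -> continuous (fun t => dpsi t * cos (l * t)) t).
{ intros t Ht; apply (continuous_mult dpsi); [exact (Hc t Ht) | apply Hcos]. }
assert (Hc2 : forall t, a <= t <= b -> continuous (fun t => psi t * sin (l * t)) t).
{ intros t Ht; apply (continuous_mult psi); [| apply Hsin].
  apply (ex_derive_continuous psi); exists (dpsi t); exact (Hd t Ht). }
assert (Ex1 : ex_RInt (fun t => dpsi t * cos (l * t)) a b).
{ apply (ex_RInt_continuous (V := R_CompleteNormedModule)).
  intros t; rewrite Rmin_left, Rmax_right by exact Hab; apply Hc1. }
assert (Ex2 : ex_RInt (fun t => psi t * sin (l * t)) a b).
{ apply (ex_RInt_continuous (V := R_CompleteNormedModule)).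
  intros t; rewrite Rmin_left, Rmax_right by exact Hab; apply Hc2. }
set (I1 := RInt (fun t => dpsi t * cos (l * t)) a b).
set (I2 := RInt (fun t => psi t * sin (l * t)) a b).
assert (Hparts : psi b * cos (l * b) - psi a * cos (l * a) = I1 - l * I2).
{ assert (H : is_RInt (fun t => dpsi t * cos (l * t) - l * (psi t * sin (l * t))) a b
                (psi b * cos (l * b) - psi a * cos (l * a))).
  { apply (is_RInt_derive (fun t => psi t * cos (l * t))).
    - intros t; rewrite Rmin_left, Rmax_right by exact Hab; intros Ht.
      replace (dpsi t * cos (l * t) - l * (psi t * sin (l * t)))
        with (dpsi t * cos (l * t) + psi t * (- (l * sin (l * t)))) by ring.
      apply (is_derive_mult psi (fun t => cos (l * t))).
      + exact (Hd t Ht).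
      + auto_derive; [trivial | ring].
      + intros; apply Rmult_comm.
    - intros t; rewrite Rmin_left, Rmax_right by exact Hab; intros Ht.
      apply (continuous_minus (fun t => dpsi t * cos (l * t))).
      + exact (Hc1 t Ht).
      + apply (continuous_scal_r (V := R_NormedModule) l
                 (fun t => psi t * sin (l * t))); exact (Hc2 t Ht). }
  apply (is_RInt_unique (V := R_CompleteNormedModule)) in H; rewrite <- H.
  apply (is_RInt_unique (V := R_CompleteNormedModule)).
  apply (is_RInt_minus (V := R_NormedModule)).
  - exact (RInt_correct _ _ _ Ex1).
  - apply (is_RInt_scal (V := R_NormedModule)); exact (RInt_correct _ _ _ Ex2). }
assert (Htrig : forall y z, Rabs (y * cos z) <= Rabs y).
{ intros y z; rewrite Rabs_mult.
  assert (Rabs (cos z) <= 1) by (apply Rabs_le; apply COS_bound).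
  generalize (Rabs_pos y); nra. }
assert (HI1 : Rabs I1 <= (b - a) * M').
{ apply abs_RInt_le_const; [exact Hab | exact Ex1 |].
  intros t Ht; eapply Rle_trans; [apply Htrig | exact (HM' t Ht)]. }
assert (Hpb := Rle_trans _ _ _ (Htrig (psi b) (l * b)) (HM b ltac:(lra))).
assert (Hpa := Rle_trans _ _ _ (Htrig (psi a) (l * a)) (HM a ltac:(lra))).
apply Rabs_le_between in HI1; apply Rabs_le_between in Hpa; apply Rabs_le_between in Hpb.
apply (Rmult_le_reg_r l); [exact Hl |].
unfold Rdiv; rewrite (Rmult_assoc _ (/ l)), Rinv_l, Rmult_1_r by lra.
replace (Rabs I2 * l) with (Rabs (l * I2))
  by (rewrite Rabs_mult, (Rabs_pos_eq l) by lra; ring).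
apply Rabs_le; lra.
Qed.

(** The comparison that keeps [sin (x * t / 2) ^ 2 / sin (t / 2)] and its
    derivative bounded near the zero of the denominator. *)
Lemma sin_scaled_half_le (x t : R) : 0 < x < 1 -> 0 < t <= PI ->
  0 <= sin (x * t / 2) <= sin (t / 2) /\ 0 < sin (t / 2) <= 1.
Proof.
intros Hx Ht.
assert (0 < x * t < t) by nra.
repeat split.
- apply sin_ge_0; lra.
- apply sin_incr_1; lra.
- apply sin_gt_0; lra.
- apply SIN_bound.
Qed.

(** Since [psi] has a removable singularity at [0], integration by parts is only
    done on [1 / l, PI], with [l = N + 1/2]; on [0, 1 / l] the bound by [2] of the
    integrand is enough.  The two parts contribute at most [2 / l] and
    [(2 * 2 + 3 * PI) / l], which is at most [16 / l] as [PI <= 4]. *)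
Lemma cos_dirichlet_defect (x : R) (N : nat) : 0 < x < 1 ->
  Rabs (PI - sin (PI * x) * csc_partial_sum x N) <= 18 / (INR N + 1 / 2).
Proof.
intros Hx.
set (l := INR N + 1 / 2).
assert (Hl : 1 / 2 <= l) by (unfold l; generalize (pos_INR N); lra).
assert (HPI4 := PI_4).
assert (HPI2 := PI2_1).
set (g := fun t => (1 - cos (x * t)) * dirichlet_kernel N t).
assert (Hg : RInt g 0 PI = PI - sin (PI * x) * csc_partial_sum x N).
{ apply (is_RInt_unique (V := R_CompleteNormedModule)).
  apply (is_RInt_ext (fun t => minus (dirichlet_kernel N t)
                                     (cos (x * t) * dirichlet_kernel N t))).
  - intros t _; unfold g, minus, plus, opp; simpl; ring.
  - apply (is_RInt_minus (V := R_NormedModule)).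
    + apply is_RInt_dirichlet_kernel.
    + apply is_RInt_cos_dirichlet_kernel; exact Hx. }
assert (Hex : forall u v, ex_RInt g u v).
{ intros u v; apply (ex_RInt_continuous (V := R_CompleteNormedModule)).
  intros t _; apply (continuous_mult (fun t => 1 - cos (x * t))).
  - apply (ex_derive_continuous (fun t => 1 - cos (x * t))); auto_derive; trivial.
  - apply continuous_dirichlet_kernel. }
set (psi := fun t => 2 * (sin (x * t / 2) ^ 2 / sin (t / 2))).
set (dpsi := fun t => 2 * (x * sin (x * t / 2) * cos (x * t / 2) / sin (t / 2)
               - sin (x * t / 2) ^ 2 * cos (t / 2) / (2 * sin (t / 2) ^ 2))).
assert (Hfactor : forall t, 0 < t <= PI -> g t = psi t * sin (l * t)).
{ intros t Ht; destruct (sin_scaled_half_le x t Hx Ht) as [_ [Hs _]].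
  unfold g, psi, l; rewrite <- sin_half_dirichlet_kernel.
  replace (cos (x * t)) with (1 - 2 * sin (x * t / 2) * sin (x * t / 2))
    by (rewrite <- cos_2a_sin; f_equal; field).
  field; lra. }
assert (Hratio : forall t, 0 < t <= PI ->
          0 <= sin (x * t / 2) / sin (t / 2) <= 1).
{ intros t Ht; destruct (sin_scaled_half_le x t Hx Ht) as [[H0 H1] [H2 _]].
  split; [apply Rdiv_le_0_compat; lra |].
  apply (Rmult_le_reg_r (sin (t / 2))); [lra |].
  unfold Rdiv; rewrite Rmult_assoc, Rinv_l; lra. }
assert (Hpsi : forall t, 0 < t <= PI -> Rabs (psi t) <= 2).
{ intros t Ht; destruct (sin_scaled_half_le x t Hx Ht) as [[H0 H1] [H2 H3]].
  assert (Hr := Hratio t Ht).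
  unfold psi.
  replace (sin (x * t / 2) ^ 2 / sin (t / 2))
    with (sin (x * t / 2) * (sin (x * t / 2) / sin (t / 2))) by (field; lra).
  apply Rabs_le; split; nra. }
assert (Hdpsi : forall t, 0 < t <= PI -> Rabs (dpsi t) <= 3).
{ intros t Ht; destruct (sin_scaled_half_le x t Hx Ht) as [_ [H2 _]].
  assert (Hr := Hratio t Ht).
  unfold dpsi.
  (* In terms of the bounded ratio [r] the derivative has no denominator left *)
  set (r := sin (x * t / 2) / sin (t / 2)) in *.
  replace (2 * _) with (2 * x * (r * cos (x * t / 2)) - r * r * cos (t / 2))
    by (unfold r; field; lra).
  assert (Hc : forall z, Rabs (cos z) <= 1) by (intros z; apply Rabs_le, COS_bound).
  eapply Rle_trans; [apply Rabs_triang |].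
  rewrite Rabs_Ropp, !Rabs_mult, (Rabs_pos_eq r), (Rabs_pos_eq 2), (Rabs_pos_eq x) by lra.
  assert (H4 := Hc (x * t / 2)); assert (H5 := Hc (t / 2)).
  assert (H6 := Rabs_pos (cos (x * t / 2))); assert (H7 := Rabs_pos (cos (t / 2))).
  assert (r * Rabs (cos (x * t / 2)) <= 1) by nra.
  assert (0 <= r * Rabs (cos (x * t / 2))) by nra.
  assert (r * r <= 1) by nra.
  assert (r * r * Rabs (cos (t / 2)) <= 1) by nra.
  nra. }
set (e := / l).
assert (He : 0 < e <= 2).
{ unfold e; split; [apply Rinv_0_lt_compat; lra |].
  apply (Rmult_le_reg_r l); [lra |]; rewrite Rinv_l; lra. }
assert (Hnear : Rabs (RInt g 0 e) <= (e - 0) * 2).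
{ apply abs_RInt_le_const; [lra | apply Hex |].
  intros t Ht; destruct (Req_dec t 0) as [-> | Ht0].
  (* The factorization fails at [0], where the integrand vanishes *)
  - unfold g; rewrite Rmult_0_r, cos_0, Rminus_diag, Rmult_0_l, Rabs_R0; lra.
  - rewrite Hfactor, Rabs_mult by lra.
    assert (H1 := Hpsi t ltac:(lra)).
    assert (H2 : Rabs (sin (l * t)) <= 1) by apply Rabs_le, SIN_bound.
    generalize (Rabs_pos (psi t)) (Rabs_pos (sin (l * t))); nra. }
assert (Hfar : Rabs (RInt g e PI) <= (2 * 2 + (PI - e) * 3) / l).
{ rewrite (RInt_ext g (fun t => psi t * sin (l * t))).
  2: { intros t; rewrite Rmin_left, Rmax_right by lra.
       intros Ht; apply Hfactor; lra. }
  apply (oscillatory_integral_bound psi dpsi); try lra.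
  - intros t Ht; destruct (sin_scaled_half_le x t Hx ltac:(lra)) as [_ [H2 _]].
    unfold psi, dpsi; auto_derive; [repeat split; lra |].
    change (t * / 2) with (t / 2); change (x * t * / 2) with (x * t / 2).
    field; lra.
  - intros t Ht; destruct (sin_scaled_half_le x t Hx ltac:(lra)) as [_ [H2 _]].
    apply (ex_derive_continuous dpsi); unfold dpsi; auto_derive.
    change (t * / 2) with (t / 2).
    assert (2 * (sin (t / 2) * (sin (t / 2) * 1)) <> 0) by nra.
    repeat split; lra.
  - intros t Ht; apply Hpsi; lra.
  - intros t Ht; apply Hdpsi; lra. }
rewrite <- Hg, <- (RInt_Chasles g 0 e PI) by apply Hex.
eapply Rle_trans; [apply Rabs_triang |].
eapply Rle_trans; [apply Rplus_le_compat; [exact Hnear | exact Hfar] |].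
unfold Rdiv; fold e; nra.
Qed.

(** * The reflection formula *)

Lemma eq_of_dist_le_div_INR (a b C : R) :
  (forall n : nat, (0 < n)%nat -> Rabs (a - b) <= C / INR n) -> a = b.
Proof.
intros H.
destruct (Req_dec a b) as [E | E]; [exact E | exfalso].
assert (Hd : 0 < Rabs (a - b)) by (apply Rabs_pos_lt; lra).
destruct (INR_archimed _ (Rabs C) Hd) as [n Hn].
assert (HS := H (S n) ltac:(lia)).
assert (H0 := pos_INR n).
assert (HC := Rle_abs C).
assert (HSn : INR (S n) = INR n + 1) by apply S_INR.
apply (Rmult_le_compat_r (INR (S n))) in HS; [| lra].
unfold Rdiv in HS; rewrite Rmult_assoc, Rinv_l in HS by lra.
nra.
Qed.

Lemma incbeta_reflection (x : R) : 0 < x < 1 ->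
  incbeta x + incbeta (1 - x) = PI / sin (PI * x).
Proof.
intros Hx.
assert (HPI := PI_RGT_0).
assert (Hs : 0 < sin (PI * x)) by (apply sin_gt_0; nra).
assert (Hs1 : sin (PI * x) <= 1) by apply SIN_bound.
enough (H : sin (PI * x) * (incbeta x + incbeta (1 - x)) = PI)
  by (rewrite <- H at 1; field; lra).
(* [18] comes from the integral, and [2] from the two remaining values of
   [incbeta], each at most [1 / n] in absolute value *)
apply (eq_of_dist_le_div_INR _ _ 20).
intros n Hn.
assert (HN : 1 <= INR n) by (apply (le_INR 1); lia).
assert (HS : INR (S n) = INR n + 1) by apply S_INR.
rewrite (incbeta_reflection_partial_sum x n Hx).
assert (Hdef := cos_dirichlet_defect x n Hx).
assert (Hinv : forall a, INR n <= a -> 1 / a <= / INR n).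
{ intros a Ha; unfold Rdiv; rewrite Rmult_1_l; apply Rinv_le_contravar; lra. }
assert (B1 := Rabs_incbeta_le (x + INR (S n)) ltac:(lra)).
assert (B2 := Rabs_incbeta_le (1 - x + INR n) ltac:(lra)).
assert (B3 := Hinv (x + INR (S n)) ltac:(lra)).
assert (B4 := Hinv (1 - x + INR n) ltac:(lra)).
assert (B5 := Hinv (INR n + 1 / 2) ltac:(lra)).
set (rem := incbeta (x + INR (S n)) - incbeta (1 - x + INR n)).
assert (Hrem : Rabs (sin (PI * x) * ((-1) ^ S n * rem)) <= 2 * / INR n).
{ rewrite !Rabs_mult, pow_1_abs, (Rabs_pos_eq (sin (PI * x))) by lra.
  assert (Rabs rem <= 2 * / INR n).
  { unfold rem; eapply Rle_trans; [apply Rabs_triang |].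
    rewrite Rabs_Ropp; lra. }
  generalize (Rabs_pos rem); nra. }
replace (sin (PI * x) * (csc_partial_sum x n + (-1) ^ S n * rem) - PI)
  with (sin (PI * x) * ((-1) ^ S n * rem)
        + - (PI - sin (PI * x) * csc_partial_sum x n)) by ring.
eapply Rle_trans; [apply Rabs_triang |].
rewrite (Rabs_Ropp (PI - _)).
unfold Rdiv in *; lra.
Qed.

Theorem proposition2p3 :
  (forall x : R, 0 < x -> incbeta (x + 1) = 1 / x - incbeta x) /\
  (forall x : R, 0 < x < 1 ->
     incbeta (1 - x) = PI / sin (PI * x) - incbeta x) /\
  (forall x : R, 0 < x < 1 ->
     incbeta (x + 1) = 1 / x - PI / sin (PI * x) + incbeta (1 - x)).
Proof.
split; [exact incbeta_succ | split].
- intros x Hx; rewrite <- (incbeta_reflection x Hx); ring.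
- intros x Hx; rewrite <- (incbeta_reflection x Hx), incbeta_succ by lra; ring.
Qed.
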